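(* Let $N$ be an inner product space and $T:N\to N$ a compact self-adjoint operator with $T\neq 0$. Let $\widehat{T}:\widehat{N}\to\widehat{N}$ be the bounded linear extension of $T$ to the completion $\widehat{N}$ of $N$, and let $\operatorname{sp}(T)$ and $\operatorname{sp}(\widehat{T})$ denote the spectra of $T$ and $\widehat{T}$. (i) If $\operatorname{sp}(T)$ is an infinite set and $\operatorname{sp}(T)\subsetneq \operatorname{sp}(\widehat{T})$, then there exist an orthonormal sequence $(x_i)_{i=1}^\infty$ in $N$ and scalars $(\lambda_i)_{i=1}^\infty$, which are the nonzero eigenvalues of $T$ (each repeated according to its multiplicity), with $T(x_i)=\lambda_i x_i$ for all $i$, such that for each $x\in N$ there exists $w_x\in N$ with $$T(x)=\sum_{i=1}^\infty \lambda_i\langle x,x_i\rangle x_i + w_x.$$ (ii) If $\operatorname{sp}(T)$ is an infinite set and $\operatorname{sp}(T)=\operatorname{sp}(\widehat{T})$, then there exist an orthonormal sequence $(x_i)_{i=1}^\infty$ in $N$ and scalars $(\lambda_i)_{i=1}^\infty$, which are the nonzero eigenvalues of $T$ (each repeated according to its multiplicity), with $T(x_i)=\lambda_i x_i$ for all $i$, such that for each $x\in N$, $$T(x)=\sum_{i=1}^\infty \lambda_i\langle x,x_i\rangle x_i.$$ (iii) If the cardinality of $\operatorname{sp}(T)$ is a nonzero natural number, then there exist a natural number $s\in\mathbb{N}\setminus\{0\}$, an orthonormal family $x_1,\dots,x_s$ in $N$ and scalars $\lambda_1,\dots,\lambda_s$, which are the nonzero eigenvalues of $T$ (each repeated according to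 its multiplicity), with $T(x_i)=\lambda_i x_i$ for all $i$, such that for all $x\in N$, $$T(x)=\sum_{i=1}^s \lambda_i\langle x,x_i\rangle x_i.$$
   Context: Inner product spaces are not assumed complete; $\widehat{N}$ is the Hilbert space completion of $N$, with $N$ dense in $\widehat{N}$. Compact means that for every bounded sequence $(u_n)$ in $N$, $(T(u_n))$ has a subsequence converging to a point of $N$. Self-adjoint means $\langle Tx,y\rangle=\langle x,Ty\rangle$ for all $x,y\in N$. The inner product is linear in the first variable. The spectrum of a bounded operator $S$ on a normed space $Z$ is the set of scalars $\lambda$ for which $S-\lambda I$ has no bounded inverse on $Z$. Series converge in the norm of $N$. *)

(* Defs.v *)
From mathcomp Require Export all_boot all_order all_algebra.
From mathcomp Require Export sesquilinear.
From mathcomp Require Export complex.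
From mathcomp Require Export all_classical all_reals all_analysis.
Export Order.TTheory GRing.Theory Num.Theory.
Export numFieldNormedType.Exports.

Set Implicit Arguments.
Unset Strict Implicit.
Unset Printing Implicit Defensive.

Local Open Scope classical_set_scope.
Local Open Scope ring_scope.

Inductive scalar_kind := RealScalars | ComplexScalars.

Definition scalars (R : realType) (k : scalar_kind) : numFieldType :=
  match k with
  | RealScalars => R
  | ComplexScalars => R[i]
  end.

Definition scalar_conj (R : realType) (k : scalar_kind) :
    scalars R k -> scalars R k :=
  match k with
  | RealScalars => idfun
  | ComplexScalars => @conjc R
  end.

Section InnerProductSpaces.
Context {K : numFieldType}.

(* In a [normedModType K] the norm is [K]-valued (with values in the
   nonnegative elements), so this says |x| = sqrt <x, x>. *)
Definition norm_from_dot (V : normedModType K) (dot : V -> V -> K) :=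
  forall x, `|x| ^+ 2 = dot x x.

Definition bounded_operator (V W : normedModType K) (f : V -> W) :=
  exists M : K, forall x, `|f x| <= M * `|x|.

Definition compact_operator (V : normedModType K) (T : V -> V) :=
  forall u : V^nat, bounded_fun u ->
    exists2 f : nat -> nat, increasing_seq f & cvgn (T \o u \o f).

Definition self_adjoint (V : normedModType K) (dot : V -> V -> K)
    (T : V -> V) :=
  forall x y, dot (T x) y = dot x (T y).

Definition spectrum (V : normedModType K) (S : V -> V) : set K :=
  [set l | ~ exists B : {linear V -> V},
     [/\ bounded_operator B,
         cancel (fun x => S x - l *: x) B &
         cancel B (fun x => S x - l *: x)]].

(* The completion is determined up to isometric isomorphism: [iota] embeds
   [V] isometrically onto a dense subspace of the complete space [W]. *)
Definition completion_embedding (V : normedModType K)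
    (W : completeNormedModType K) (dotV : V -> V -> K) (dotW : W -> W -> K)
    (iota : V -> W) :=
  (forall x y, dotW (iota x) (iota y) = dotV x y) /\ dense (range iota).

Definition is_eigenvalue (V : lmodType K) (T : V -> V) (l : K) :=
  exists2 x, x != 0 & T x = l *: x.

Definition eigenspace_of (V : lmodType K) (T : V -> V) (l : K) : set V :=
  [set x | T x = l *: x].

Definition has_dimension (V : lmodType K) (E : set V) (m : nat) :=
  exists b : 'I_m -> V,
    (forall c : 'I_m -> K, \sum_(i < m) c i *: b i = 0 ->
       forall i, c i = 0) /\
    E = [set x | exists c : 'I_m -> K, x = \sum_(i < m) c i *: b i].

Definition orthonormal_family (I : eqType) (V : lmodType K)
    (dot : V -> V -> K) (x : I -> V) :=
  forall i j, dot (x i) (x j) = (i == j)%:R.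

(* [lam] lists the nonzero eigenvalues of [T], each of them occurring as many
   times as the dimension of its eigenspace. *)
Definition lists_nonzero_eigenvalues (I : Type) (V : lmodType K)
    (T : V -> V) (lam : I -> K) :=
  range lam = [set l | is_eigenvalue T l /\ l != 0] /\
  forall i, exists2 m : nat,
    has_dimension (eigenspace_of T (lam i)) m &
    ([set j | lam j = lam i] #= `I_m)%card.

End InnerProductSpaces.

(* Main.v *)
From HB Require Import structures.
Require Import Defs.
From mathcomp Require Import ring.

Set Implicit Arguments.
Unset Strict Implicit.
Unset Printing Implicit Defensive.

Local Open Scope classical_set_scope.
Local Open Scope ring_scope.

(** The whole argument takes place in [N]: compactness asks that the images of a
bounded sequence accumulate at a point of [N], and this provides every limit
that the spectral theorem needs.

A nonzero compact self-adjoint [S] has an eigenvalue of modulus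
[m = sup { |S x| : |x| = 1 }]. Indeed, for a unit vector [x],
[|S (S x) - m^2 x|^2 <= m^2 (m^2 - |S x|^2)], so along a maximizing sequence
whose images converge to some [z], one gets [S (S z) = m^2 z] with [z != 0]; the
factorization [(S - m) (S + m) z = 0] then yields an eigenvector for [m] or [-m]
([top_eigenvector]).

Starting from [T], one removes such a top eigenvector [e] by composing with the
projection along [e], and repeats. The operator after [n] steps is
[T - sum_(i < n) lam_i <., e_i> e_i], it is again compact and self-adjoint, its
norm is [|lam_n|], and it vanishes on [e_0, ..., e_(n-1)], which makes the [e_i]
orthonormal eigenvectors of [T]. Either the process stops at the operator [0]
and [T] is a finite sum, or it goes on for ever; then [lam_n] tends to [0],
since otherwise the orthogonal vectors [T e_n] would have no convergent
subsequence, and the remainder of the series, of norm at most [|lam_n| |y|] at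
[y], tends to [0] ([spectral_dichotomy]).

In both cases a vector orthogonal to all [e_i] is killed by [T], so an
eigenvector with a nonzero eigenvalue [l] is a combination of the finitely many
[e_i] with [lam_i = l]: the list is complete and repeats each eigenvalue
according to its multiplicity ([diagonal_lists_eigenvalues]).

The size of the spectrum tells the two cases apart. A finite expansion has an
explicit resolvent at every [l] outside [0] and the [lam_i], so its spectrum is
finite ([finite_spectrum_sub]); an infinite list contains infinitely many
distinct eigenvalues, because each value is taken finitely often
([spectrum_infinite]). In parts (i) and (ii) the series converges to [T y]
itself, so that the vector [w] of part (i) can be taken to be [0]. *)

(** * Real and complex scalars *)

Section Scalars.
Context {R : realType} {k : scalar_kind}.
Local Notation K := (scalars R k).

Lemma scalar_conj_real (a : K) : a \is Num.real -> scalar_conj a = a.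
Proof. by case: k a => //= a /complex_realP [r ->]; rewrite conjc_real. Qed.

Lemma mul_scalar_conj (a : K) : a * scalar_conj a = `|a| ^+ 2.
Proof.
case: k a => /= a; first by rewrite real_normK ?num_real ?expr2.
by rewrite -normCK.
Qed.

Lemma scalar_archimedean (a : K) : 0 <= a -> exists n, a < n%:R.
Proof.
case: k a => /= a a0.
  by exists (Num.Def.archi_bound a); exact: archi_boundP.
have /complex_realP[r ar] : a \is Num.real by exact: ger0_real.
have r0 : 0 <= r by move: a0; rewrite ar -[0]/(0%:C%C) lecR.
exists (Num.Def.archi_bound r).
by rewrite ar -(rmorph_nat (real_complex R)) ltcR archi_boundP.
Qed.

Lemma real_scalar_sup (A : set R) (M : R) : A !=set0 ->
  (forall a, A a -> a <= M) ->
  exists m, (forall a, A a -> a <= m) /\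
            (forall e, 0 < e -> exists2 a, A a & m - e < a).
Proof.
move=> A0 AM; have supA : has_sup A by split => //; exists M.
exists (sup A); split=> [|e e0]; first exact: sup_upper_bound.
by have [a Aa ea] := sup_adherent e0 supA; exists a.
Qed.

(** Nonnegative complex numbers are real, so the completeness of the real line
carries over to order-bounded sets of nonnegative scalars of either kind. *)
Lemma scalar_sup (A : set K) (M : K) : A !=set0 ->
  (forall a, A a -> 0 <= a <= M) ->
  exists m, (forall a, A a -> a <= m) /\
            (forall e, 0 < e -> exists2 a, A a & m - e < a).
Proof.
case: k A M => /= A M A0 AM.
  by apply: (real_scalar_sup A0 (M := M)) => a /AM /andP[].
have realA a : A a -> a = (complex.Re a)%:C%C.
  by move=> /AM /andP[/ger0_Im a0 _]; rewrite [LHS]complexE a0 mulr0 addr0.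
have [|a /AM|m [mub madh]] :=
    @real_scalar_sup (fun r => A r%:C%C) (complex.Re M).
- by case: A0 => a Aa; exists (complex.Re a); rewrite -realA.
- by case/andP => _; rewrite lecE => /andP[].
exists m%:C%C; split => [a Aa|e e0].
  by rewrite (realA a) // lecR mub // -realA.
have [r er] : exists r, e = r%:C%C by apply/complex_realP/gtr0_real.
have [|a Aa ma] := madh r; first by move: e0; rewrite er -[0]/(0%:C%C) ltcR.
by exists a%:C%C => //; rewrite er -rmorphB ltcR.
Qed.

End Scalars.

(** * Orthogonality *)

Section Dot.
Context {R : realType} {k : scalar_kind}.
Local Notation K := (scalars R k).
Context {N : normedModType K} {dot : {dot N for @scalar_conj R k}}.
Context (hN : norm_from_dot dot).

Lemma dotC x y : dot x y = scalar_conj (dot y x).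
Proof. by rewrite [LHS](hermitian_subproof (s := dot)) mul1r. Qed.

Lemma dotZr (a : K) x y : dot x (a *: y) = scalar_conj a * dot x y.
Proof. by rewrite linearZr. Qed.

Lemma dot_suml (I : Type) (s : seq I) (P : pred I) (F : I -> N) y :
  dot (\sum_(i <- s | P i) F i) y = \sum_(i <- s | P i) dot (F i) y.
Proof.
by apply: (big_morph (fun u => dot u y)) => [u v|]; rewrite ?linearDl ?linear0l.
Qed.

Lemma dot_swap0 x y : dot x y = 0 -> dot y x = 0.
Proof. by move=> xy0; rewrite dotC xy0 scalar_conj_real ?real0. Qed.

Lemma dot_unit x : `|x| = 1 -> dot x x = 1.
Proof. by rewrite -hN => ->; rewrite expr1n. Qed.

Lemma sqr_normB x y : `|x - y| ^+ 2 = `|x| ^+ 2 - dot x y - dot y x + `|y| ^+ 2.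
Proof.
by rewrite !hN linearBl /= !linearBr /= opprB addrA [LHS]addrAC.
Qed.

Lemma sqr_normB_orthogonal x y :
  dot x y = 0 -> `|x - y| ^+ 2 = `|x| ^+ 2 + `|y| ^+ 2.
Proof. by move=> xy0; rewrite sqr_normB xy0 (dot_swap0 xy0) !subr0. Qed.

(** Pythagoras for the component of [x] orthogonal to [e]; the nonnegativity of the
left-hand side is the Cauchy-Schwarz inequality against a unit vector. *)
Lemma sqr_norm_rejection x e : `|e| = 1 ->
  `|x - dot x e *: e| ^+ 2 = `|x| ^+ 2 - `|dot x e| ^+ 2.
Proof.
move=> e1; rewrite sqr_normB dotZr linearZl /= normrZ e1 mulr1.
rewrite [dot e x]dotC mul_scalar_conj mulrC mul_scalar_conj.
by rewrite subrK.
Qed.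

Lemma norm_rejection_le x e : `|e| = 1 -> `|x - dot x e *: e| <= `|x|.
Proof.
move=> e1; rewrite -(ler_pXn2r (n := 2)) ?nnegrE //.
by rewrite sqr_norm_rejection // gerBl exprn_ge0.
Qed.

Lemma norm_dot_unit_le x e : `|e| = 1 -> `|dot x e| <= `|x|.
Proof.
move=> e1; rewrite -(ler_pXn2r (n := 2)) ?nnegrE //.
by rewrite -subr_ge0 -sqr_norm_rejection // exprn_ge0.
Qed.

Lemma orthonormal_norm (I : eqType) (x : I -> N) i :
  orthonormal_family dot x -> `|x i| = 1.
Proof. by move=> ox; apply/eqP; rewrite -(@eqrXn2 _ 2) // expr1n hN ox eqxx. Qed.

End Dot.

(** * Compact operators *)

Section CompactOperator.
Context {R : realType} {k : scalar_kind}.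
Local Notation K := (scalars R k).
Context {N : normedModType K}.

Lemma bounded_seq (u : N^nat) (M : K) :
  (forall n, `|u n| <= M) -> bounded_fun u.
Proof.
move=> uM; exists M; split; first exact: ger0_real (le_trans _ (uM 0)).
by move=> M' MM' n _; rewrite /= (le_trans (uM n)) ?ltW.
Qed.

Lemma increasing_seq_ge_id (f : nat -> nat) n : increasing_seq f -> (n <= f n)%N.
Proof.
move/increasing_seqP => fS; elim: n => // n nfn; exact: leq_ltn_trans (fS n).
Qed.

Lemma compact_subsequence (S : N -> N) (u : N^nat) (M : K) :
  compact_operator S -> (forall n, `|u n| <= M) ->
  exists (f : nat -> nat) (z : N), increasing_seq f /\
    forall e, 0 < e -> exists n0, forall n, (n0 <= n)%N -> `|z - S (u (f n))| < e.
Proof.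
move=> cS uM; have [f incf /cvgrPdist_lt cv] := cS u (bounded_seq uM).
exists f, (lim (S \o u \o f @ \oo)); split => // e e0.
by have [n0 _ n0P] := cv e e0; exists n0.
Qed.

(** Otherwise some unit vectors [u n] satisfy [n < |S (u n)|], and no subsequence of
the images converges. *)
Lemma compact_bounded_sphere (S : N -> N) : compact_operator S ->
  exists M : K, forall x, `|x| = 1 -> `|S x| <= M.
Proof.
move=> cS; apply: contrapT => /forallNP unbounded.
have /choice[u uP] n : exists x, `|x| = 1 /\ n%:R < `|S x|.
  have /existsNP[x /not_implyP[x1 /negP nx]] := unbounded n%:R.
  by exists x; split => //; rewrite real_ltNge ?normr_real ?realn.
have u1 n : `|u n| <= 1 by rewrite (uP n).1.
have [f [z [incf cv]]] := compact_subsequence cS u1.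
have [n0 n0P] := cv 1 ltr01.
have [|n nP] := @scalar_archimedean _ _ (1 + `|z|); first by rewrite addr_ge0.
have : `|S (u (f (maxn n0 n)))| < 1 + `|z|.
  rewrite -[X in `|X|](subrK z) (le_lt_trans (ler_normD _ _)) // ltrD2r distrC.
  by rewrite n0P ?leq_maxl.
apply/negP; rewrite -real_leNgt ?realD ?normr_real ?real1 //.
rewrite (le_trans (ltW nP)) // (le_trans _ (ltW (uP _).2)) // ler_nat.
by rewrite (leq_trans (leq_maxr n0 n)) // increasing_seq_ge_id.
Qed.

(** Deflated operators have this form, with [F] a projection. *)
Lemma compact_comp_contraction (S F : N -> N) :
  compact_operator S -> (forall x, `|F x| <= `|x|) -> compact_operator (S \o F).
Proof.
move=> cS leF u /pinfty_ex_gt0[M _ uM].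
apply: (cS (F \o u)); apply: (bounded_seq (M := M)) => n.
by rewrite (le_trans (leF _)) // uM.
Qed.

End CompactOperator.

(** * Existence of an eigenvector realizing the norm *)

Section TopEigenvector.
Context {R : realType} {k : scalar_kind}.
Local Notation K := (scalars R k).
Context {N : normedModType K} {dot : {dot N for @scalar_conj R k}}.
Context (hN : norm_from_dot dot).
Context (S : {linear N -> N}).
Context (cS : compact_operator S).
Context (saS : self_adjoint dot S).

(** The last clause makes [|l|] the norm of [S]; it is what controls the remainders of
the spectral expansion. *)
Definition top_eigenpair (x : N) (l : K) :=
  [/\ `|x| = 1, l != 0, l \is Num.real, S x = l *: x &
      forall y, `|S y| <= `|l| * `|y|].

Lemma norm_normalize (x : N) : x != 0 -> `| `|x|^-1 *: x| = 1.
Proof. by move=> x0; rewrite normrZ normfV normr_id mulVf ?normr_eq0. Qed.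

Lemma sphere_bound_homogeneous (m : K) :
  (forall x, `|x| = 1 -> `|S x| <= m) -> forall x, `|S x| <= m * `|x|.
Proof.
move=> Sm x; have [->|x0] := eqVneq x 0; first by rewrite linear0 !normr0 mulr0.
have := Sm _ (norm_normalize x0); rewrite linearZ normrZ normfV normr_id.
by rewrite ler_pdivrMl ?normr_gt0 // mulrC.
Qed.

(** Expanding the square gives [|S (S x)|^2 - 2 m^2 |S x|^2 + m^4], because
[<S (S x), x> = |S x|^2]; then [|S (S x)| <= m |S x|]. Hence a unit vector that
almost maximizes [|S x|] is almost an eigenvector of [S^2]. *)
Lemma square_near_eigenvector (m : K) x : 0 <= m ->
  (forall x, `|S x| <= m * `|x|) -> `|x| = 1 ->
  `|S (S x) - m ^+ 2 *: x| ^+ 2 <= m ^+ 2 * (m ^+ 2 - `|S x| ^+ 2).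
Proof.
move=> m0 Sm x1; rewrite (sqr_normB hN) dotZr linearZl /= saS -hN.
rewrite [dot x _](_ : _ = `|S x| ^+ 2); last by rewrite -saS hN.
rewrite scalar_conj_real ?rpredX ?ger0_real // normrZ x1 mulr1 normrX ger0_norm //.
have le1 : `|S (S x)| ^+ 2 <= m ^+ 2 * `|S x| ^+ 2.
  by rewrite -exprMn ler_pXn2r ?nnegrE ?mulr_ge0.
rewrite -subr_ge0 [X in 0 <= X](_ : _ = m ^+ 2 * `|S x| ^+ 2 - `|S (S x)| ^+ 2).
  by rewrite subr_ge0.
ring.
Qed.

(** The point [z] is a limit of images [S x] of near-maximizers [x], for which
[S (S x)] is close to [m^2 x]; applying [S] to this relation and passing to the
limit in [S x] gives the relation for [z]. *)
Lemma square_eigenvector_of_maximizers (m : K) (z : N) : 0 < m ->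
  (forall x, `|S x| <= m * `|x|) ->
  (forall e d, 0 < e -> 0 < d ->
    exists x, [/\ `|x| = 1, `|z - S x| < e & m - d < `|S x|]) ->
  S (S z) = m ^+ 2 *: z.
Proof.
move=> m0 Sm approx; have m_ge0 := ltW m0.
have close e : 0 < e -> `|S (S z) - m ^+ 2 *: z| <= e * (3 * m ^+ 2).
  move=> e0; have e_ge0 := ltW e0.
  (* With this tolerance, m^2 - |S x|^2 = (m - |S x|) (m + |S x|) <= e^2. *)
  have [|x [x1 zx mx]] := approx e (e ^+ 2 / (2 * m)) e0.
    by rewrite divr_gt0 ?exprn_gt0 // mulr_gt0.
  have le_Sx : `|S x| <= m by rewrite (le_trans (Sm x)) // x1 mulr1.
  have le1 : `|S (S x) - m ^+ 2 *: x| <= m * e.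
    rewrite -(ler_pXn2r (n := 2)) ?nnegrE // ?mulr_ge0 //.
    rewrite (le_trans (square_near_eigenvector m_ge0 Sm x1)) // exprMn.
    rewrite ler_pM2l ?exprn_gt0 // subr_sqr.
    have -> : e ^+ 2 = e ^+ 2 / (2 * m) * (2 * m).
      by rewrite divfK // mulf_neq0 ?gt_eqF ?pnatr_eq0.
    apply: ler_pM; rewrite ?subr_ge0 ?addr_ge0 //.
      by rewrite lerBlDr -lerBlDl ltW.
    by rewrite mulr_natl mulr2n lerD2l.
  have -> : S (S z) - m ^+ 2 *: z = S (S (z - S x)) - m ^+ 2 *: (z - S x)
      + S (S (S x) - m ^+ 2 *: x).
    rewrite scalerBr !(linearB S) [S (_ *: x)]linearZ /= opprB -addrA.
    by rewrite [m ^+ 2 *: S x - _ + _]addrC !subrKA.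
  have -> : e * (3 * m ^+ 2) = m * (m * e) + m ^+ 2 * e + m * (m * e) :> K by ring.
  rewrite (le_trans (ler_normD _ _)) // lerD //.
    rewrite (le_trans (ler_normB _ _)) // lerD //.
      by rewrite (le_trans (Sm _)) // ler_pM2l // (le_trans (Sm _)) // ler_pM2l // ltW.
    by rewrite normrZ ger0_norm ?exprn_ge0 // ler_pM2l ?exprn_gt0 // ltW.
  by rewrite (le_trans (Sm _)) // ler_pM2l.
apply/eqP; rewrite -subr_eq0 -normr_le0; apply/negPn/negP.
rewrite -real_ltNge ?normr_real ?real0 // => a0.
(* Taking e = a / (6 m^2), where a is the norm in question, gives a <= a / 2. *)
have c0 : 0 < 3 * m ^+ 2 by rewrite mulr_gt0 ?exprn_gt0.
have := close (`|S (S z) - m ^+ 2 *: z| / (2 * (3 * m ^+ 2))).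
rewrite invfM mulrA divfK ?gt_eqF // => close2.
have := close2 (divr_gt0 (divr_gt0 a0 (ltr0Sn _ _)) c0).
by rewrite ler_pdivlMr // ger_pMr // lern1.
Qed.

Lemma top_eigenvector : (exists x, S x != 0) ->
  exists (x : N) (l : K), top_eigenpair x l.
Proof.
move=> [x0 Sx0].
have x0N0 : x0 != 0 by apply: contraNneq Sx0 => ->; rewrite linear0.
have [M SM] := compact_bounded_sphere cS.
have [||m [mub madh]] := @scalar_sup _ _ [set `|S x| | x in [set x | `|x| = 1]] M.
- exists `|S ( `|x0|^-1 *: x0)|; exists ( `|x0|^-1 *: x0) => //.
  exact: norm_normalize.
- by move=> _ [x x1 <-]; rewrite normr_ge0 SM.
have Sm : forall x, `|S x| <= m * `|x|.
  by apply: sphere_bound_homogeneous => x x1; apply: mub; exists x.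
have m_gt0 : 0 < m.
  have : 0 < m * `|x0| by rewrite (lt_le_trans _ (Sm _)) ?normr_gt0.
  by rewrite pmulr_lgt0 ?normr_gt0.
have /choice[u uP] n : exists x, `|x| = 1 /\ m - n.+1%:R^-1 < `|S x|.
  have [|_ [x x1 <-] mx] := madh n.+1%:R^-1; first by rewrite invr_gt0 ltr0n.
  by exists x.
have u1 n : `|u n| <= 1 by rewrite (uP n).1.
have [f [z [incf cv]]] := compact_subsequence cS u1.
have approx e d : 0 < e -> 0 < d ->
    exists x, [/\ `|x| = 1, `|z - S x| < e & m - d < `|S x|].
  move=> e0 d0; have [n0 n0P] := cv e e0.
  have [|n nP] := @scalar_archimedean _ _ d^-1; first by rewrite invr_ge0 ltW.
  exists (u (f (maxn n0 n))); split; first exact: (uP _).1.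
    by rewrite n0P ?leq_maxl.
  apply: le_lt_trans (uP _).2; rewrite lerD2l lerN2.
  rewrite -[leRHS]invrK lef_pV2 ?posrE ?invr_gt0 ?ltr0n // (le_trans (ltW nP)) //.
  rewrite ler_nat ltnW // ltnS.
  by rewrite (leq_trans (leq_maxr n0 n)) // increasing_seq_ge_id.
(* A z equal to 0 would force |S x| to be both below and above m / 2. *)
have z0 : z != 0.
  have m2 : 0 < m / 2 by rewrite divr_gt0.
  have [x [_ zx mx]] := approx _ _ m2 m2.
  apply: contraTneq zx => ->; rewrite sub0r normrN -real_leNgt ?normr_real ?gtr0_real //.
  by apply: ltW; rewrite (le_lt_trans _ mx) // [m in m - _]splitr addrK.
have SSz := square_eigenvector_of_maximizers m_gt0 Sm approx.
have normalize v l : v != 0 -> S v = l *: v -> `|l| = m -> l \is Num.real ->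
    exists (x : N) (l : K), top_eigenpair x l.
  move=> v0 Sv lm lr; exists (`|v|^-1 *: v), l; split => //.
  - exact: norm_normalize.
  - by rewrite -normr_eq0 lm gt_eqF.
  - by rewrite linearZ /= Sv !scalerA mulrC.
  - by move=> y; rewrite lm.
(* (S - m) (S + m) z = 0: either z or (S + m) z is the eigenvector. *)
have [w0|w0] := eqVneq (S z + m *: z) 0.
  apply: (normalize z (- m)) => //; rewrite ?rpredN ?gtr0_real //.
    by rewrite scaleNr; apply/eqP; rewrite -addr_eq0 w0.
  by rewrite normrN gtr0_norm.
apply: (normalize _ m w0); rewrite ?gtr0_real ?gtr0_norm //.
by rewrite linearD linearZ /= SSz scalerDr scalerA -expr2 addrC.
Qed.

End TopEigenvector.

(** * Deflation *)

Section Rejection.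
Context {R : realType} {k : scalar_kind}.
Local Notation K := (scalars R k).
Context {N : normedModType K} (dot : {dot N for @scalar_conj R k}).

Lemma kernel_eigenvector_orthogonal (S : N -> N) (e v : N) (l : K) :
  self_adjoint dot S -> S e = l *: e -> l != 0 -> S v = 0 -> dot v e = 0.
Proof.
move=> saS Se l0 Sv; apply: dot_swap0; apply/eqP.
have /eqP : l * dot e v = 0 by rewrite -linearZl /= -Se saS Sv linear0r.
by rewrite mulf_eq0 (negPf l0).
Qed.

Definition rejection (e x : N) : N := x - dot x e *: e.

Lemma rejection_is_linear e : linear (rejection e).
Proof.
move=> a x y; rewrite /rejection linearPl /= scalerBr scalerDl scalerA.
by rewrite opprD addrACA.
Qed.

HB.instance Definition _ e :=
  GRing.isLinear.Build K N N *:%R (rejection e) (rejection_is_linear e).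

(** As [e] is an eigenvector with a real eigenvalue, the composite is
[S - l <., e> e], a difference of self-adjoint operators. *)
Lemma self_adjoint_rejection (S : {linear N -> N}) (e : N) (l : K) :
  self_adjoint dot S -> S e = l *: e -> l \is Num.real ->
  self_adjoint dot (S \o rejection e).
Proof.
move=> saS Se lr x y; rewrite /= /rejection !(linearB S) ![S (_ *: _)]linearZ /= Se.
rewrite linearBl linearBr /= saS !linearZl /= !dotZr -[scalar_conj (dot _ _)]dotC.
by rewrite (scalar_conj_real lr) [l * dot e y]mulrC mulrCA [l * _]mulrC.
Qed.

End Rejection.

Section Deflation.
Context {R : realType} {k : scalar_kind}.
Local Notation K := (scalars R k).
Context {N : normedModType K} (dot : {dot N for @scalar_conj R k}).
Context (hN : norm_from_dot dot).

(** A choice of eigenpairs made once for all operators, so that the iterated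
deflations can be defined by plain recursion. *)
Lemma top_eigenpair_choice : exists top : {linear N -> N} -> N * K,
  forall S : {linear N -> N}, compact_operator S -> self_adjoint dot S ->
    (exists x, S x != 0) -> top_eigenpair S (top S).1 (top S).2.
Proof.
suff /choice[top topP] : forall S : {linear N -> N}, exists p : N * K,
    compact_operator S -> self_adjoint dot S -> (exists x, S x != 0) ->
    top_eigenpair S p.1 p.2 by exists top.
move=> S; have [[cS [saS S0]]|nS] :=
    pselect (compact_operator S /\ self_adjoint dot S /\ exists x, S x != 0).
  by have [x [l xl]] := top_eigenvector hN cS saS S0; exists (x, l).
by exists (0, 0) => cS saS S0; case: nS.
Qed.

Context (T : {linear N -> N}).
Context (cT : compact_operator T).
Context (saT : self_adjoint dot T).
Context (top : {linear N -> N} -> N * K).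
Context (topP : forall S : {linear N -> N}, compact_operator S ->
  self_adjoint dot S -> (exists x, S x != 0) -> top_eigenpair S (top S).1 (top S).2).

Fixpoint deflated (n : nat) : {linear N -> N} :=
  if n is n'.+1 then deflated n' \o rejection dot (top (deflated n')).1 else T.

Let e n := (top (deflated n)).1.
Let l n := (top (deflated n)).2.

(** The first [n] deflations remove genuine eigenvectors; beyond the first zero
operator, [top] carries no information. *)
Definition nonzero_below (n : nat) :=
  forall i, (i < n)%N -> exists x, deflated i x != 0.

Lemma nonzero_belowW m n : (m <= n)%N -> nonzero_below n -> nonzero_below m.
Proof. by move=> mn nz i im; apply: nz; exact: leq_trans mn. Qed.

Lemma deflated_compact_self_adjoint n : nonzero_below n ->
  compact_operator (deflated n) /\ self_adjoint dot (deflated n).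
Proof.
elim: n => [|n IH] nz //; have [cS saS] := IH (nonzero_belowW (leqnSn n) nz).
have [e1 _ lr eE _] := topP cS saS (nz n (ltnSn n)).
split; last exact: self_adjoint_rejection eE lr.
by apply: compact_comp_contraction => // x; exact: (norm_rejection_le hN).
Qed.

Lemma deflated_top n i : nonzero_below n -> (i < n)%N ->
  top_eigenpair (deflated i) (e i) (l i).
Proof.
move=> nz lt_in.
have [cS saS] := deflated_compact_self_adjoint (nonzero_belowW (ltnW lt_in) nz).
by apply: topP => //; exact: nz.
Qed.

Lemma deflatedE n y : nonzero_below n ->
  deflated n y = T y - \sum_(0 <= i < n) (l i * dot y (e i)) *: e i.
Proof.
elim: n => [|n IH] nz; first by rewrite big_geq // subr0.
have [_ _ _ eE _] := deflated_top nz (ltnSn n).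
rewrite /= linearB linearZ /= eE (IH (nonzero_belowW (leqnSn n) nz)).
by rewrite big_nat_recr //= opprD addrA scalerA mulrC.
Qed.

(** The last removed vector is killed by the projection. An earlier [e i] is killed
by [deflated n] already, hence orthogonal to [e n], and the projection fixes it. *)
Lemma deflated_kills n i : nonzero_below n -> (i < n)%N -> deflated n (e i) = 0.
Proof.
elim: n => // n IH nz; rewrite ltnS leq_eqVlt => /orP[/eqP ->|lt_in].
  have [e1 _ _ _ _] := deflated_top nz (ltnSn n).
  by rewrite /= /rejection (dot_unit hN) // scale1r subrr linear0.
have S0 := IH (nonzero_belowW (leqnSn n) nz) lt_in.
have [_ saS] := deflated_compact_self_adjoint (nonzero_belowW (leqnSn n) nz).
have [_ l0 _ eE _] := deflated_top nz (ltnSn n).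
have ei0 := kernel_eigenvector_orthogonal saS eE l0 S0.
by rewrite /= /rejection [dot _ _]ei0 scale0r subr0.
Qed.

Lemma deflation_orthogonal n i j : nonzero_below n -> (i < j < n)%N ->
  dot (e i) (e j) = 0.
Proof.
move=> nz /andP[ij jn]; have [_ l0 _ eE _] := deflated_top nz jn.
have nzj := nonzero_belowW (ltnW jn) nz.
have [_ saS] := deflated_compact_self_adjoint nzj.
exact: kernel_eigenvector_orthogonal saS eE l0 (deflated_kills nzj ij).
Qed.

Lemma deflation_orthonormal n i j : nonzero_below n -> (i < n)%N -> (j < n)%N ->
  dot (e i) (e j) = (i == j)%:R.
Proof.
move=> nz lt_in jn; case: ltngtP => [ij|ji|->].
- by rewrite (deflation_orthogonal nz) // ij.
- by rewrite (dot_swap0 (deflation_orthogonal nz _)) // ji.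
- by have [e1 _ _ _ _] := deflated_top nz jn; exact: dot_unit.
Qed.

Lemma deflation_eigenvector n i : nonzero_below n -> (i < n)%N -> T (e i) = l i *: e i.
Proof.
move=> nz lt_in; have [_ _ _ <- _] := deflated_top nz lt_in.
rewrite deflatedE; last exact: nonzero_belowW (ltnW lt_in) nz.
rewrite big_nat big1 ?subr0 // => j /andP[_ ji].
by rewrite (dot_swap0 (deflation_orthogonal nz _)) ?ji // mulr0 scale0r.
Qed.

(** [l i.+1] is an eigenvalue of [deflated i] too, since [e i.+1] is orthogonal to
[e i]; and [|l i|] is the norm of [deflated i]. *)
Lemma deflation_nonincreasing n i : nonzero_below n -> (i.+1 < n)%N ->
  `|l i.+1| <= `|l i|.
Proof.
move=> nz iSn; have [e1 _ _ eE _] := deflated_top nz iSn.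
have [_ _ _ _ le_l] := deflated_top nz (ltnW iSn).
have -> : `|l i.+1| = `|deflated i.+1 (e i.+1)| by rewrite eE normrZ e1 mulr1.
rewrite /= /rejection [dot _ _](dot_swap0 (deflation_orthogonal nz _)) ?ltnSn //.
by rewrite scale0r subr0 (le_trans (le_l _)) // e1 mulr1.
Qed.

Definition diagonalizes (I : eqType) (x : I -> N) (lam : I -> K) :=
  [/\ orthonormal_family dot x, forall i, T (x i) = lam i *: x i &
      forall i, lam i != 0].

(** If all eigenvalues had modulus at least [d], any two of the orthogonal vectors
[T (x n)] would be at distance at least [d], against compactness. *)
Lemma compact_eigenvalues_small (x : nat -> N) (lam : nat -> K) d :
  diagonalizes x lam -> 0 < d -> exists n, `|lam n| < d.
Proof.
move=> [ox Tx _] d0; apply: contrapT => /forallNP large.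
have {}large n : d <= `|lam n|.
  by rewrite real_leNgt ?normr_real ?gtr0_real //; apply/negP.
have x1 n : `|x n| <= 1 by rewrite (orthonormal_norm hN).
have [f [z [incf cv]]] := compact_subsequence cT x1.
have [|n0 n0P] := cv (d / 2); first by rewrite divr_gt0.
pose u := T (x (f n0)); pose v := T (x (f n0.+1)).
have : `|u - v| < d.
  have -> : u - v = (z - v) - (z - u) by rewrite opprB [RHS]addrC addrA subrK.
  rewrite [d]splitr (le_lt_trans (ler_normB _ _)) // ltrD // n0P //.
have ne : f n0 != f n0.+1.
  by rewrite (inj_eq (increasing_seq_injective incf)) neq_ltn ltnSn.
apply/negP; rewrite -real_leNgt ?normr_real ?gtr0_real //.
have d_ge0 := ltW d0; rewrite -(ler_pXn2r (n := 2)) ?nnegrE //.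
rewrite (sqr_normB_orthogonal hN); last first.
  by rewrite /u /v !Tx linearZl /= dotZr ox (negPf ne) !mulr0.
rewrite (@le_trans _ _ (`|u| ^+ 2)) //; last by rewrite lerDl exprn_ge0.
by rewrite ler_pXn2r ?nnegrE // /u Tx normrZ (orthonormal_norm hN) ?mulr1.
Qed.

(** The first alternative occurs when some deflation vanishes; the number of terms
is then the least index where this happens. *)
Lemma spectral_dichotomy :
  (exists (s : nat) (x : 'I_s -> N) (lam : 'I_s -> K),
     diagonalizes x lam /\
     forall y, T y = \sum_(i < s) (lam i * dot y (x i)) *: x i) \/
  (exists (x : nat -> N) (lam : nat -> K),
     [/\ diagonalizes x lam,
       forall d, 0 < d -> exists n0, forall n, (n0 <= n)%N -> `|lam n| < d &
       forall y, series (fun i => (lam i * dot y (x i)) *: x i) @ \oo --> T y]).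
Proof.
have [[n nz0]|nz] := pselect (exists n, ~ exists x, deflated n x != 0).
  left; have /ex_minnP[s /asboolP s0 smin] :
      exists n, `[< ~ exists x, deflated n x != 0 >] by exists n; apply/asboolP.
  have nz : nonzero_below s.
    move=> i lt_is; apply: contrapT => /asboolP /smin.
    by rewrite leqNgt lt_is.
  exists s, (fun i => e i), (fun i => l i); split; first split.
  - by move=> i j; rewrite (deflation_orthonormal nz).
  - by move=> i; exact: deflation_eigenvector nz _.
  - by move=> i; have [] := deflated_top nz (ltn_ord i).
  move=> y; apply/eqP; rewrite -subr_eq0 -(big_mkord xpredT
    (fun i => (l i * dot y (e i)) *: e i)) -deflatedE //.
  by apply: contrapT => /negP y0; apply: s0; exists y.
right; have {}nz n : nonzero_below n.
  by move=> i _; apply: contrapT => i0; apply: nz; exists i.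
have diag : diagonalizes e l.
  split.
  - move=> i j; apply: (deflation_orthonormal (nz (maxn i j).+1)).
      by rewrite ltnS leq_maxl.
    by rewrite ltnS leq_maxr.
  - by move=> i; exact: deflation_eigenvector (nz i.+1) _.
  - by move=> i; have [] := deflated_top (nz i.+1) (ltnSn i).
have decay d : 0 < d -> exists n0, forall n, (n0 <= n)%N -> `|l n| < d.
  move=> /(compact_eigenvalues_small diag)[n0 n0d]; exists n0.
  elim=> [|n IH]; first by rewrite leqn0 => /eqP <-.
  rewrite leq_eqVlt => /orP[/eqP <- //|]; rewrite ltnS => /IH.
  by apply: le_lt_trans; exact: deflation_nonincreasing (nz n.+2) _.
(* The remainder after n terms is deflated n y, of norm at most |l n| |y|; the
   denominator 1 + |y| avoids a division by 0. *)
exists e, l; split => // y; apply/cvgrPdist_lt => d d0.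
have [n0 n0P] := decay (d / (1 + `|y|)) (divr_gt0 d0 (ltr_wpDr (normr_ge0 y) ltr01)).
exists n0 => // n /= /n0P ln; rewrite /series /= -deflatedE //.
have [_ _ _ _ le_l] := deflated_top (nz n.+1) (ltnSn n).
rewrite (le_lt_trans (le_l y)) //.
have y1 : 0 < 1 + `|y| by rewrite ltr_wpDr.
rewrite ltr_pdivlMr // in ln; apply: le_lt_trans ln.
by rewrite ler_wpM2l // lerDr.
Qed.

End Deflation.

(** * Completeness of the list of eigenvalues *)

Section EigenvalueList.
Context {R : realType} {k : scalar_kind}.
Local Notation K := (scalars R k).
Context {N : normedModType K} {dot : {dot N for @scalar_conj R k}}.
Context (hN : norm_from_dot dot).
Context (T : {linear N -> N}).
Context (saT : self_adjoint dot T).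

Lemma dot_sum_orthonormal (I : eqType) (x : I -> N) (c : I -> K) (s : seq I) j :
  orthonormal_family dot x -> uniq s -> j \in s ->
  dot (\sum_(i <- s) c i *: x i) (x j) = c j.
Proof.
move=> ox us js; rewrite dot_suml (bigD1_seq j) //= linearZl /= ox eqxx mulr1.
by rewrite big1 ?addr0 // => i /negPf ij; rewrite linearZl /= ox ij mulr0.
Qed.

Lemma orthonormal_neq0 (I : eqType) (x : I -> N) i :
  orthonormal_family dot x -> x i != 0.
Proof. by move=> ox; rewrite -normr_eq0 (orthonormal_norm hN) // oner_eq0. Qed.

Lemma eigenvalue_in_spectrum l : is_eigenvalue T l -> spectrum T l.
Proof.
move=> [v /eqP v0 Tv] [B [_ BK _]]; apply: v0.
by rewrite -[v]BK Tv subrr linear0.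
Qed.

Section Diagonal.
Context {I : choiceType} {x : I -> N} {lam : I -> K}.
Context (diag : diagonalizes dot T x lam).
Context (vanish : forall y, (forall i, dot y (x i) = 0) -> T y = 0).

Lemma diagonal_real i : scalar_conj (lam i) = lam i.
Proof.
have [ox Tx _] := diag; have := saT (x i) (x i).
rewrite Tx linearZl dotZr /= ox eqxx !mulr1; exact: esym.
Qed.

Lemma eigenvector_coefficient0 l v i :
  T v = l *: v -> lam i != l -> dot v (x i) = 0.
Proof.
have [ox Tx _] := diag => Tv ne; apply/eqP.
have := saT v (x i); rewrite Tv Tx linearZl dotZr /= diagonal_real => /eqP.
by rewrite -subr_eq0 -mulrBl mulf_eq0 subr_eq0 eq_sym (negPf ne).
Qed.

(** The difference of both sides is again in the eigenspace of [l], and it is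
orthogonal to every [x j]: for [lam j = l] by construction, for [lam j != l]
because eigenvectors of distinct eigenvalues are orthogonal. So [T] kills it, and
[l != 0] forces it to be [0]. *)
Lemma eigenvector_expansion l v (s : seq I) : l != 0 -> T v = l *: v ->
  uniq s -> (forall j, (j \in s) = (lam j == l)) ->
  v = \sum_(j <- s) dot v (x j) *: x j.
Proof.
have [ox Tx _] := diag => l0 Tv us sE; apply/eqP; rewrite -subr_eq0.
set w := v - _.
have Tw : T w = l *: w.
  rewrite (linearB T) Tv scalerBr linear_sum scaler_sumr; congr (_ - _).
  apply: eq_big_seq => j; rewrite sE => /eqP lj.
  by rewrite linearZ /= Tx lj !scalerA mulrC.
have : T w = 0.
  apply: vanish => j; have [js|] := boolP (j \in s).
    by rewrite linearBl /= dot_sum_orthonormal // subrr.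
  by rewrite sE; exact: eigenvector_coefficient0 Tw.
by move/eqP; rewrite Tw scaler_eq0 (negPf l0).
Qed.

Lemma eigenspace_dimension l (s : seq I) : l != 0 ->
  uniq s -> (forall j, (j \in s) = (lam j == l)) ->
  has_dimension (eigenspace_of T l) (size s).
Proof.
have [ox Tx _] := diag => l0 us sE.
have idx_inj : injective (tnth (in_tuple s)) by apply/tuple_uniqP.
exists (x \o tnth (in_tuple s)); split => [c c0 i|].
  have ob : orthonormal_family dot (x \o tnth (in_tuple s)).
    by move=> a b; rewrite /= ox (inj_eq idx_inj).
  have := dot_sum_orthonormal c ob (index_enum_uniq _) (mem_index_enum i).
  by rewrite c0 linear0l => <-.
apply/seteqP; split => v /= => [Tv|[c ->]].
  exists (fun i => dot v (x (tnth (in_tuple s) i))).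
  by rewrite [LHS](eigenvector_expansion l0 Tv us sE) [LHS]big_tnth.
rewrite /eigenspace_of /= linear_sum scaler_sumr; apply: eq_bigr => i _.
have /eqP li : lam (tnth (in_tuple s) i) == l by rewrite -sE mem_tnth.
by rewrite linearZ /= Tx li !scalerA mulrC.
Qed.

Lemma diagonal_lists_eigenvalues :
  (forall l, l != 0 -> finite_set [set j | lam j = l]) ->
  lists_nonzero_eigenvalues T lam.
Proof.
have [ox Tx lam0] := diag => fin.
pose s l := finmap.enum_fset (fset_set [set j | lam j = l]).
have us l : uniq (s l) by exact: finmap.fset_uniq.
have sE l (l0 : l != 0) j : (j \in s l) = (lam j == l).
  rewrite [LHS](in_fset_set (fin l l0)).
  by apply/idP/idP => [/set_mem/eqP|/eqP jl]; last exact/mem_set.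
split=> [|i].
  apply/seteqP; split => [_ [i _ <-]|l [[v v0 Tv] l0]].
    by split => //; exists (x i) => //; exact: orthonormal_neq0.
  have := eigenvector_expansion l0 Tv (us l) (sE l l0).
  case sl : (s l) => [|j s'] vE; first by rewrite vE big_nil eqxx in v0.
  by exists j => //; apply/eqP; rewrite -sE // sl mem_head.
exists (size (s (lam i))); first exact: eigenspace_dimension (us _) (sE _ _).
by rewrite -[X in (X #= _)%card](fset_setK (fin _ (lam0 i))); apply/card_eq_fsetP.
Qed.

End Diagonal.

(** * The spectrum in the finite and in the infinite case *)

Section FiniteResolvent.
Context {s : nat} {x : 'I_s -> N} {lam : 'I_s -> K}.
Context (diag : diagonalizes dot T x lam).
Context (TE : forall y, T y = \sum_(i < s) (lam i * dot y (x i)) *: x i).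

(** The inverse of [T - l]: if [T x - l x = y], then [<y, x_i> = (lam_i - l) <x, x_i>]
and [x = l^-1 (T x - y)], where [T x] is expanded along the [x_i]. *)
Definition finite_resolvent (l : K) (y : N) : N :=
  l^-1 *: (\sum_(i < s) (lam i / (lam i - l) * dot y (x i)) *: x i - y).

Lemma finite_resolvent_is_linear l : linear (finite_resolvent l).
Proof.
move=> a y z; rewrite /finite_resolvent [a *: (l^-1 *: _)]scalerA [a * _]mulrC.
rewrite -scalerA -scalerDr.
congr (_ *: _); rewrite scalerBr opprD [RHS]addrACA; congr (_ + _).
rewrite scaler_sumr -big_split; apply: eq_bigr => i _ /=.
by rewrite linearPl /= mulrDr scalerDl scalerA mulrCA.
Qed.

HB.instance Definition _ l :=
  GRing.isLinear.Build K N N *:%R (finite_resolvent l)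
    (finite_resolvent_is_linear l).

Lemma finite_resolvent_bounded l : bounded_operator (finite_resolvent l).
Proof.
have [ox _ _] := diag.
exists (`|l^-1| * (\sum_(i < s) `|lam i / (lam i - l)| + 1)) => y.
rewrite normrZ -mulrA ler_wpM2l // (le_trans (ler_normB _ _)) //.
rewrite mulrDl mul1r lerD2r mulr_suml (le_trans (ler_norm_sum _ _ _)) //.
apply: ler_sum => i _; rewrite normrZ (orthonormal_norm hN) // mulr1 normrM ler_wpM2l //.
by rewrite norm_dot_unit_le // (orthonormal_norm hN).
Qed.

Lemma dot_sum_ord (c : 'I_s -> K) j : dot (\sum_(i < s) c i *: x i) (x j) = c j.
Proof.
have [ox _ _] := diag.
by apply: dot_sum_orthonormal ox _ _; rewrite ?index_enum_uniq ?mem_index_enum.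
Qed.

Lemma finite_spectrum_sub : spectrum T `<=` [set 0] `|` range lam.
Proof.
move=> l spl; apply: contrapT => /not_orP[/eqP l0 nlam]; apply: spl.
have lamN i : lam i - l != 0.
  by rewrite subr_eq0; apply/eqP => li; apply: nlam; exists i.
exists (finite_resolvent l); split => [|y|y] /=.
- exact: finite_resolvent_bounded.
- rewrite /finite_resolvent.
  have -> : \sum_(i < s) (lam i / (lam i - l) * dot (T y - l *: y) (x i)) *: x i
      = T y.
    rewrite [RHS]TE; apply: eq_bigr => i _; congr (_ *: _).
    rewrite linearBl /= [dot (l *: y) _]linearZl /= TE dot_sum_ord.
    by rewrite -mulrBl mulrA divfK.
  by rewrite subKr scalerA mulVf // scale1r.
- have coef i : dot (finite_resolvent l y) (x i) = dot y (x i) / (lam i - l).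
    rewrite /finite_resolvent linearZl /= linearBl /= dot_sum_ord.
    rewrite -[X in _ - X]mul1r -[X in _ - X * _](divff (lamN i)) -!mulrBl subKr.
    by rewrite !mulrA mulVf // mul1r mulrC.
  rewrite TE (eq_bigr (fun i => (lam i / (lam i - l) * dot y (x i)) *: x i)).
    by rewrite /finite_resolvent scalerA divff // scale1r subKr.
  by move=> i _; rewrite coef mulrA mulrAC.
Qed.

End FiniteResolvent.

(** A finite spectrum would contain the range of [lam], and the index set [nat]
would be a finite union of finite fibres. *)
Lemma spectrum_infinite (lam : nat -> K) :
  (forall n, is_eigenvalue T (lam n)) ->
  (forall l, l != 0 -> finite_set [set j | lam j = l]) ->
  (forall n, lam n != 0) -> infinite_set (spectrum T).
Proof.
move=> eig fib lam0 fsp; apply: infinite_nat.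
have frange : finite_set (range lam).
  apply: sub_finite_set fsp => _ [n _ <-]; exact: eigenvalue_in_spectrum.
apply: sub_finite_set (bigcup_finite frange (F := fun l => [set j | lam j = l]) _).
  by move=> n _; exists (lam n) => //; exists n.
by move=> _ [n _ <-]; exact: fib.
Qed.

End EigenvalueList.

Theorem theorem2p4 (R : realType) (k : scalar_kind)
    (N : normedModType (scalars R k))
    (dot : {dot N for @scalar_conj R k})
    (hN : norm_from_dot dot)
    (Nhat : completeNormedModType (scalars R k))
    (dothat : {dot Nhat for @scalar_conj R k})
    (hNhat : norm_from_dot dothat)
    (iota : {linear N -> Nhat})
    (hiota : completion_embedding dot dothat iota)
    (T : {linear N -> N})
    (hTcompact : compact_operator T)
    (hTsa : self_adjoint dot T)
    (hT0 : exists x, T x != 0)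
    (That : {linear Nhat -> Nhat})
    (hThatbounded : bounded_operator That)
    (hThatext : forall x, That (iota x) = iota (T x)) :
  [/\ (infinite_set (spectrum T) -> spectrum T `<` spectrum That ->
       exists (x : nat -> N) (lam : nat -> scalars R k),
         [/\ orthonormal_family dot x,
             lists_nonzero_eigenvalues T lam,
             forall i, T (x i) = lam i *: x i &
             forall y, exists S w : N,
               series (fun i => (lam i * dot y (x i)) *: x i) @ \oo --> S /\
               T y = S + w]),
      (infinite_set (spectrum T) -> spectrum T = spectrum That ->
       exists (x : nat -> N) (lam : nat -> scalars R k),
         [/\ orthonormal_family dot x,
             lists_nonzero_eigenvalues T lam,
             forall i, T (x i) = lam i *: x i &
             forall y,
               series (fun i => (lam i * dot y (x i)) *: x i) @ \oo --> T y])
    & ((exists2 n : nat, (0 < n)%N & (spectrum T #= `I_n)%card) ->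
       exists (s : nat) (x : 'I_s -> N) (lam : 'I_s -> scalars R k),
         (0 < s)%N /\
         [/\ orthonormal_family dot x,
             lists_nonzero_eigenvalues T lam,
             forall i, T (x i) = lam i *: x i &
             forall y,
               T y = \sum_(i < s) (lam i * dot y (x i)) *: x i])].
Proof.
have [top topP] := top_eigenpair_choice hN.
have [[s [x [lam [diag TE]]]]|[x [lam [diag decay TE]]]] :=
    spectral_dichotomy hN hTcompact hTsa topP; have [ox Tx lam0] := diag.
- have fin_range : finite_set (range lam) by exact: finite_image.
  have fin_sp : finite_set (spectrum T).
    apply: sub_finite_set (finite_spectrum_sub hN diag TE) _.
    by rewrite finite_setU; split => //; exact: finite_set1.
  split => // _; exists s, x, lam; split.
    case: s x lam diag TE {ox Tx lam0 fin_range} => // x lam _ TE.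
    by have [y] := hT0; rewrite TE big_ord0 eqxx.
  split => //; apply: (diagonal_lists_eigenvalues hN hTsa diag).
    by move=> y y0; rewrite TE big1 // => i _; rewrite y0 mulr0 scale0r.
  by move=> l _; exact: finite_finset.
have vanish y : (forall i, dot y (x i) = 0) -> T y = 0.
  move=> y0; apply: (cvg_unique _ (TE y)) => //=.
  rewrite (_ : series _ = fun=> 0); first exact: cvg_cst.
  by apply/funext => n; rewrite /series /= big1 // => i _; rewrite y0 mulr0 scale0r.
have fibres l : l != 0 -> finite_set [set j | lam j = l].
  rewrite -normr_gt0 => /decay[n0 n0P]; apply: sub_finite_set (finite_II n0).
  by move=> j /= jl; rewrite ltnNge; apply/negP => /n0P; rewrite jl ltxx.
have lists := diagonal_lists_eigenvalues hN hTsa diag vanish fibres.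
have inf_sp : infinite_set (spectrum T).
  apply: (spectrum_infinite _ fibres lam0) => n.
  by have x0 := orthonormal_neq0 hN n ox; exists (x n).
split => [_ _|_ _|[n _ sp_n]].
- exists x, lam; split => // y; exists (T y), 0; split; last by rewrite addr0.
  exact: TE.
- by exists x, lam.
- by case: inf_sp; exists n.
Qed.
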